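(* Suppose $\rho>\max\left\{-\frac{\sigma_x^2+3\sigma_y^2}{4\sigma_x\sigma_y},\,-\frac{3\sigma_x^2+\sigma_y^2}{4\sigma_x\sigma_y}\right\}$. Then $(\mathbf a^*,\mathbf b^* )$ is a local equilibrium of $K$: all four first-order partial derivatives of $K(\mathbf a,\mathbf b)$ with respect to $x_1,y_1,x_2,y_2$ vanish at $(\mathbf a^*,\mathbf b^* )$, the point $\mathbf a^*$ is a strict local minimizer of $\mathbf a\mapsto K(\mathbf a,\mathbf b^* )$, and $\mathbf b^*$ is a strict local maximizer of $\mathbf b\mapsto K(\mathbf a^*,\mathbf b)$.
   Context: Standing setup. Fix $\sigma_x,\sigma_y>0$ and $\rho\in(-1,1)$, and let $(\xi,\eta)$ be a bivariate normal random vector with mean $(0,0)$ and covariance matrix $\Sigma=\begin{pmatrix}\sigma_x^2&\rho\sigma_x\sigma_y\\ \rho\sigma_x\sigma_y&\sigma_y^2\end{pmatrix}$. Player I (the minimizer) chooses $\mathbf a=(x_1,y_1)\in\mathbb R^2$ and Player II (the maximizer) chooses $\mathbf b=(x_2,y_2)\in\mathbb R^2$. Let $C_1(\mathbf a,\mathbf b)=\{(x,y):(x_1-x)^2+(y_1-y)^2<(x_2-x)^2+(y_2-y)^2\}$ and $C_2(\mathbf a,\mathbf b)=\{(x,y):(x_1-x)^2+(y_1-y)^2>(x_2-x)^2+(y_2-y)^2\}$. The payoff to Player II (paid by Player I) is $K(\mathbf a,\mathbf b)=x_1+y_1$ if $\mathbf a=\mathbf b$, and $K(\mathbf a,\mathbf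 b)=(x_1+y_1)\,P((\xi,\eta)\in C_1(\mathbf a,\mathbf b))+(x_2+y_2)\,P((\xi,\eta)\in C_2(\mathbf a,\mathbf b))$ if $\mathbf a\neq\mathbf b$. For $\mathbf a=(x,y)$ write $-\mathbf a=(-x,-y)$. Let $x_2^*=\frac{\sqrt{2\pi(\sigma_x^2+2\rho\sigma_x\sigma_y+\sigma_y^2)}}{4}$, $\mathbf b^*=(x_2^*,x_2^* )$ and $\mathbf a^*=(-x_2^*,-x_2^* )$. *)

(* Defs.v *)
From Stdlib Require Import Reals Lra ClassicalEpsilon.
Open Scope R_scope.

Definition improper_int_R (f : R -> R) (v : R) : Prop :=
  forall eps : R, 0 < eps -> exists M : R, forall a b : R,
    a <= - M -> M <= b ->
    exists pr : Riemann_integrable f a b, Rabs (RiemannInt pr - v) < eps.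

(* The value of the improper integral (chosen by classical choice;
   meaningful whenever the integral exists). *)
Definition int_R (f : R -> R) : R :=
  epsilon (inhabits 0) (fun v => improper_int_R f v).

(* Density of the centred bivariate normal law with covariance
   [[sx^2, rho sx sy],[rho sx sy, sy^2]]. *)
Definition binorm_density (sx sy rho x y : R) : R :=
  / (2 * PI * sx * sy * sqrt (1 - rho ^ 2)) *
  exp (- / (2 * (1 - rho ^ 2)) *
       (x ^ 2 / sx ^ 2 - 2 * rho * x * y / (sx * sy) + y ^ 2 / sy ^ 2)).

Definition indic (C : R -> R -> Prop) (x y : R) : R :=
  match excluded_middle_informative (C x y) with
  | left _ => 1
  | right _ => 0
  end.

(* P((xi,eta) in C) as the iterated improper integral of the density
   over C (equal to the double integral by Tonelli). *)
Definition binorm_prob (sx sy rho : R) (C : R -> R -> Prop) : R :=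
  int_R (fun x => int_R (fun y => binorm_density sx sy rho x y * indic C x y)).

Definition C1 (x1 y1 x2 y2 : R) (x y : R) : Prop :=
  (x1 - x) ^ 2 + (y1 - y) ^ 2 < (x2 - x) ^ 2 + (y2 - y) ^ 2.
Definition C2 (x1 y1 x2 y2 : R) (x y : R) : Prop :=
  (x1 - x) ^ 2 + (y1 - y) ^ 2 > (x2 - x) ^ 2 + (y2 - y) ^ 2.

Definition K (sx sy rho : R) (x1 y1 x2 y2 : R) : R :=
  match excluded_middle_informative (x1 = x2 /\ y1 = y2) with
  | left _ => x1 + y1
  | right _ =>
      (x1 + y1) * binorm_prob sx sy rho (C1 x1 y1 x2 y2)
      + (x2 + y2) * binorm_prob sx sy rho (C2 x1 y1 x2 y2)
  end.

Definition xstar (sx sy rho : R) : R :=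
  sqrt (2 * PI * (sx ^ 2 + 2 * rho * sx * sy + sy ^ 2)) / 4.

(* Main.v *)
Require Import Defs.
From Stdlib Require Import Reals Lra ClassicalEpsilon FunctionalExtensionality PropExtensionality.
From Coquelicot Require Import Coquelicot.
Open Scope R_scope.

(** For [y1 < y2] the set on which a point is closer to [a] than to [b] is the half-plane
    [u . z < c] with [u = b - a] and [c = (|b|^2 - |a|^2) / 2], so its probability is
    [Phi (c / sigma u)], where [sigma u ^ 2] is the variance of [u . (xi, eta)]. As an
    iterated integral this is the identity
    [E (Phi (al + be * X)) = Phi (al / sqrt (1 + be ^ 2))] for standard normal [X], obtained
    by differentiating in [al]: the integrand is odd up to a constant at [al = 0], and its
    derivative is Gaussian after completing the square.

    With [s] for [xstar], [tau ^ 2 = Var (xi + eta)], [alpha = Cov (xi, xi + eta) / tau ^ 2]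
    and [r ^ 2 = h ^ 2 + k ^ 2], expanding at [b = (s + h, s + k)] gives
    [sigma u * sqrt (2 PI) * K = - 2 s Q + O(r ^ 3)], where the first-order terms cancel by
    the choice of [s] and [Q = (3/2 - alpha) h ^ 2 + (1/2 + alpha) k ^ 2]. The two
    hypotheses on [rho] say exactly that [Q] is positive definite. The minimizer is handled
    by the symmetry [K (- b) (- a) = - K a b]. *)

(** * The Gaussian integral *)

Definition gauss (t : R) : R := exp (- t ^ 2 / 2).

Definition gaussI (z : R) : R := RInt gauss 0 z.

Lemma gauss_pos (t : R) : 0 < gauss t.
Proof. apply exp_pos. Qed.

Lemma exp_le_compat (x y : R) : x <= y -> exp x <= exp y.
Proof. intros [H | ->]; [now apply Rlt_le, exp_increasing|apply Rle_refl]. Qed.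

Lemma gauss_le_1 (t : R) : gauss t <= 1.
Proof. unfold gauss. rewrite <- exp_0. apply exp_le_compat. nra. Qed.

Lemma gauss_ge (t : R) : 1 - t ^ 2 / 2 <= gauss t.
Proof. unfold gauss. pose proof (exp_ineq1_le (- t ^ 2 / 2)). lra. Qed.

Lemma gauss_opp (t : R) : gauss (- t) = gauss t.
Proof. unfold gauss. f_equal. field. Qed.

Lemma continuous_gauss (t : R) : continuous gauss t.
Proof.
  apply (ex_derive_continuous (V := R_NormedModule)).
  unfold gauss. auto_derive. exact I.
Qed.

Lemma ex_RInt_gauss (a b : R) : ex_RInt gauss a b.
Proof.
  apply (ex_RInt_continuous (V := R_CompleteNormedModule)).
  intros z _. apply continuous_gauss.
Qed.

Lemma is_derive_gaussI (z : R) : is_derive gaussI z (gauss z).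
Proof.
  apply (is_derive_RInt gauss gaussI 0 z).
  - apply filter_forall. intros b. apply (RInt_correct gauss), ex_RInt_gauss.
  - apply continuous_gauss.
Qed.

Lemma continuous_gaussI (z : R) : continuous gaussI z.
Proof.
  apply (ex_derive_continuous (V := R_NormedModule)).
  exists (gauss z). apply is_derive_gaussI.
Qed.

Lemma gaussI_0 : gaussI 0 = 0.
Proof. apply (RInt_point (V := R_CompleteNormedModule)). Qed.

Lemma is_RInt_gauss (a b : R) : is_RInt gauss a b (gaussI b - gaussI a).
Proof.
  apply (is_RInt_derive (V := R_CompleteNormedModule) gaussI gauss); intros x _.
  - apply is_derive_gaussI.
  - apply continuous_gauss.
Qed.

Lemma gaussI_opp (z : R) : gaussI (- z) = - gaussI z.
Proof.
  apply (is_RInt_unique (V := R_CompleteNormedModule)).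
  apply (is_RInt_ext (fun y => opp (opp (gauss (- y))))).
  { intros y _. rewrite gauss_opp. apply Ropp_involutive. }
  apply (is_RInt_opp (fun y => opp (gauss (- y))) 0 (- z) (gaussI z)).
  apply (is_RInt_comp_opp gauss).
  rewrite Ropp_0, Ropp_involutive.
  replace (gaussI z) with (gaussI z - gaussI 0) by (rewrite gaussI_0; lra).
  apply is_RInt_gauss.
Qed.

Lemma gaussI_MVT (a b : R) :
  exists c, Rmin a b <= c <= Rmax a b /\ gaussI b - gaussI a = gauss c * (b - a).
Proof.
  apply (MVT_gen gaussI a b gauss); intros x _.
  - apply is_derive_gaussI.
  - apply continuity_pt_filterlim, continuous_gaussI.
Qed.

Lemma gaussI_incr (a b : R) : a <= b -> gaussI a <= gaussI b.
Proof.
  intros H. destruct (gaussI_MVT a b) as [c [_ Hc]].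
  pose proof (gauss_pos c). nra.
Qed.

Lemma gaussI_linear (z : R) : Rabs (gaussI z - z) <= Rabs z ^ 3.
Proof.
  destruct (gaussI_MVT 0 z) as [c [Hc E]]. rewrite gaussI_0 in E.
  replace (gaussI z - z) with (z * (gauss c - 1)) by lra.
  rewrite Rabs_mult. simpl. rewrite Rmult_1_r.
  apply Rmult_le_compat_l; [apply Rabs_pos|].
  pose proof (gauss_le_1 c). pose proof (gauss_ge c).
  rewrite Rabs_left1 by lra.
  rewrite <- Rabs_mult, Rabs_pos_eq by nra.
  enough (c ^ 2 <= z * z) by nra.
  revert Hc. unfold Rmin, Rmax. destruct (Rle_dec 0 z); nra.
Qed.

(* [gaussI t ^ 2 / 2 + gauss_aux t] is constant, because the substitution
   [y = t x] shows that the two derivatives cancel. *)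
Definition gauss_aux (t : R) : R :=
  RInt (fun x => gauss (t * sqrt (1 + x ^ 2)) / (1 + x ^ 2)) 0 1.

Lemma gauss_aux_eq (t x : R) :
  gauss (t * sqrt (1 + x ^ 2)) / (1 + x ^ 2) =
  exp (- (t ^ 2 * (1 + x ^ 2)) / 2) / (1 + x ^ 2).
Proof.
  unfold gauss. do 3 f_equal. rewrite Rpow_mult_distr, pow2_sqrt; [ring|nra].
Qed.

Lemma gauss_aux_alt (t : R) :
  gauss_aux t = RInt (fun x => exp (- (t ^ 2 * (1 + x ^ 2)) / 2) / (1 + x ^ 2)) 0 1.
Proof. apply RInt_ext. intros x _. apply gauss_aux_eq. Qed.

Lemma continuous_of_ex_derive (f : R -> R) (x : R) : ex_derive f x -> continuous f x.
Proof. apply (ex_derive_continuous (V := R_NormedModule)). Qed.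

Lemma ex_RInt_of_ex_derive (f : R -> R) (a b : R) :
  (forall x, ex_derive f x) -> ex_RInt f a b.
Proof.
  intros H. apply (ex_RInt_continuous (V := R_CompleteNormedModule)). intros z _. now apply continuous_of_ex_derive.
Qed.

Lemma is_derive_gauss_aux (t : R) : is_derive gauss_aux t (- (gauss t * gaussI t)).
Proof.
  apply (is_derive_ext
    (fun t => RInt (fun x => exp (- (t ^ 2 * (1 + x ^ 2)) / 2) / (1 + x ^ 2)) 0 1)).
  { intros u. symmetry. apply gauss_aux_alt. }
  assert (D : forall u x, is_derive
      (fun u => exp (- (u ^ 2 * (1 + x ^ 2)) / 2) / (1 + x ^ 2)) u
      (- (u * exp (- (u ^ 2 * (1 + x ^ 2)) / 2)))).
  { intros u x. auto_derive; [nra|]. unfold Rdiv. simpl pow.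
    set (e := exp _). field. nra. }
  replace (- (gauss t * gaussI t)) with
    (RInt (fun x => Derive (fun u => exp (- (u ^ 2 * (1 + x ^ 2)) / 2) / (1 + x ^ 2)) t) 0 1).
  - apply is_derive_RInt_param.
    + apply filter_forall. intros u x _. eexists; apply D.
    + intros x _.
      apply (continuity_2d_pt_ext (fun u v => - (u * exp (- (u ^ 2 * (1 + v ^ 2)) / 2)))).
      { intros u v. symmetry. apply is_derive_unique, D. }
      apply continuity_2d_pt_opp, continuity_2d_pt_mult; [apply continuity_2d_pt_id1|].
      apply continuity_1d_2d_pt_comp with (f := exp).
      { apply derivable_continuous_pt, derivable_pt_exp. }
      apply (continuity_2d_pt_ext (fun u v => - ((u * u) * (1 + v * v)) * / 2)).
      { intros u v. field. }
      repeat first [apply continuity_2d_pt_mult | apply continuity_2d_pt_opp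
        | apply continuity_2d_pt_plus | apply continuity_2d_pt_id1
        | apply continuity_2d_pt_id2 | apply continuity_2d_pt_const].
    + apply filter_forall. intros u. apply ex_RInt_of_ex_derive.
      intros x. auto_derive. nra.
  - rewrite (RInt_ext _ (fun x => scal (- gauss t) (t * gauss (t * x + 0)))).
    + apply (is_RInt_unique (V := R_CompleteNormedModule)).
      replace (- (gauss t * gaussI t)) with (scal (- gauss t) (gaussI t))
        by (change (- gauss t * gaussI t = - (gauss t * gaussI t)); ring).
      apply (is_RInt_scal (fun x => t * gauss (t * x + 0))).
      apply (is_RInt_comp_lin gauss t 0).
      rewrite !Rplus_0_r, Rmult_0_r, Rmult_1_r.
      apply (RInt_correct gauss), ex_RInt_gauss.
    + intros x _. etransitivity; [apply is_derive_unique, D|].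
      change (- (t * exp (- (t ^ 2 * (1 + x ^ 2)) / 2)) =
              - gauss t * (t * gauss (t * x + 0))).
      unfold gauss.
      replace (- (t ^ 2 * (1 + x ^ 2)) / 2) with (- t ^ 2 / 2 + - (t * x + 0) ^ 2 / 2)
        by field.
      rewrite exp_plus. ring.
Qed.

Lemma gauss_aux_0 : gauss_aux 0 = PI / 4.
Proof.
  rewrite gauss_aux_alt. apply (is_RInt_unique (V := R_CompleteNormedModule)).
  apply (is_RInt_ext (fun x => / (1 + x ^ 2))).
  { intros x _.
    change (/ (1 + x ^ 2) = exp (- (0 ^ 2 * (1 + x ^ 2)) / 2) / (1 + x ^ 2)).
    replace (- (0 ^ 2 * (1 + x ^ 2)) / 2) with 0 by field.
    rewrite exp_0. unfold Rdiv. ring. }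
  replace (PI / 4) with (atan 1 - atan 0) by (rewrite atan_1, atan_0; lra).
  apply (is_RInt_derive (V := R_CompleteNormedModule) atan (fun x => / (1 + x ^ 2))); intros x _.
  - apply is_derive_Reals, derivable_pt_lim_atan.
  - apply continuous_of_ex_derive. auto_derive. nra.
Qed.

Lemma gauss_aux_bounds (t : R) : 0 <= gauss_aux t <= gauss t.
Proof.
  rewrite gauss_aux_alt.
  assert (E : ex_RInt (fun x => exp (- (t ^ 2 * (1 + x ^ 2)) / 2) / (1 + x ^ 2)) 0 1).
  { apply ex_RInt_of_ex_derive. intros x. auto_derive. nra. }
  assert (P : forall x, 0 <= exp (- (t ^ 2 * (1 + x ^ 2)) / 2) / (1 + x ^ 2) <= gauss t).
  { intros x. pose proof (exp_pos (- (t ^ 2 * (1 + x ^ 2)) / 2)) as Hp. split.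
    - apply Rlt_le, Rdiv_lt_0_compat; nra.
    - apply Rle_div_l; [nra|]. apply Rle_trans with (gauss t).
      + unfold gauss. apply exp_le_compat. nra.
      + pose proof (gauss_pos t). nra. }
  split.
  - apply RInt_ge_0; [lra|exact E|]. intros; apply P.
  - replace (gauss t) with (RInt (fun _ => gauss t) 0 1)
      by (rewrite RInt_const; change ((1 - 0) * gauss t = gauss t); ring).
    apply RInt_le; [lra|exact E|apply ex_RInt_const|]. intros; apply P.
Qed.

Lemma gaussI_sqr (t : R) : gaussI t ^ 2 / 2 + gauss_aux t = PI / 4.
Proof.
  assert (D : forall u, is_derive (fun t => gaussI t ^ 2 / 2 + gauss_aux t) u 0).
  { intros u.
    replace 0 with (plus (gaussI u * gauss u) (- (gauss u * gaussI u)))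
      by (change (gaussI u * gauss u + - (gauss u * gaussI u) = 0); ring).
    apply (is_derive_plus (fun t => gaussI t ^ 2 / 2)).
    - replace (gaussI u * gauss u) with (INR 2 * gauss u * gaussI u ^ 1 / 2)
        by (simpl; field).
      apply (is_derive_ext (fun t => / 2 * gaussI t ^ 2)).
      { intros x. change (/ 2 * gaussI x ^ 2 = gaussI x ^ 2 / 2). field. }
      replace (INR 2 * gauss u * gaussI u ^ 1 / 2)
        with (/ 2 * (INR 2 * gauss u * gaussI u ^ 1)) by field.
      apply (is_derive_scal (fun t => gaussI t ^ 2)).
      apply (is_derive_pow gaussI 2 u (gauss u)). apply is_derive_gaussI.
    - apply is_derive_gauss_aux. }
  destruct (MVT_gen (fun t => gaussI t ^ 2 / 2 + gauss_aux t) 0 t (fun _ => 0))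
    as [c [_ E]].
  - intros x _. apply D.
  - intros x _. apply continuity_pt_filterlim.
    apply (continuous_of_ex_derive (fun t => gaussI t ^ 2 / 2 + gauss_aux t)).
    eexists; apply D.
  - rewrite gaussI_0, gauss_aux_0 in E. lra.
Qed.

Definition half_mass : R := sqrt (2 * PI) / 2.

Lemma half_mass_pos : 0 < half_mass.
Proof.
  unfold half_mass. pose proof PI_RGT_0.
  assert (0 < sqrt (2 * PI)) by (apply sqrt_lt_R0; lra). lra.
Qed.

Lemma half_mass_sqr : half_mass ^ 2 = PI / 2.
Proof.
  unfold half_mass. pose proof PI_RGT_0.
  replace ((sqrt (2 * PI) / 2) ^ 2) with (sqrt (2 * PI) ^ 2 / 4) by field.
  rewrite pow2_sqrt; lra.
Qed.

Lemma gaussI_le (z : R) : gaussI z <= half_mass.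
Proof.
  pose proof (gaussI_sqr z). pose proof (gauss_aux_bounds z).
  pose proof half_mass_sqr. pose proof half_mass_pos. nra.
Qed.

Lemma gaussI_abs (z : R) : Rabs (gaussI z) <= half_mass.
Proof.
  apply Rabs_le. pose proof (gaussI_le z). pose proof (gaussI_le (- z)).
  rewrite gaussI_opp in *. lra.
Qed.

Lemma gaussI_lim (eps : R) :
  0 < eps -> exists T, 0 < T /\ forall t, T <= t -> half_mass - eps < gaussI t.
Proof.
  intros He. pose proof half_mass_pos as Hp.
  set (d := half_mass * eps / 2).
  assert (Hd : 0 < d) by (unfold d; nra).
  exists (1 + 2 / d). assert (0 < 2 / d) by (apply Rdiv_lt_0_compat; lra).
  split; [lra|]. intros t Ht.
  assert (G : gauss t < d).
  { unfold gauss. replace (- t ^ 2 / 2) with (- (t ^ 2 / 2)) by field. rewrite exp_Ropp.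
    pose proof (exp_ineq1_le (t ^ 2 / 2)).
    rewrite <- (Rinv_inv d). apply Rinv_lt_contravar.
    - apply Rmult_lt_0_compat; [now apply Rinv_0_lt_compat|apply exp_pos].
    - unfold Rdiv in *. nra. }
  pose proof (gaussI_sqr t). pose proof (gauss_aux_bounds t). pose proof half_mass_sqr.
  assert (0 <= gaussI t) by (rewrite <- gaussI_0; apply gaussI_incr; lra).
  unfold d in *. nra.
Qed.

(** * Improper integrals and the Gaussian convolution *)

Lemma improper_int_R_iff (f : R -> R) (v : R) :
  improper_int_R f v <->
  forall eps, 0 < eps -> exists M, forall a b, a <= - M -> M <= b ->
    exists I, is_RInt f a b I /\ Rabs (I - v) < eps.
Proof.
  split; intros H eps He; destruct (H eps He) as [M HM]; exists M; intros a b Ha Hb;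
    destruct (HM a b Ha Hb) as [pr Hpr].
  - exists (RiemannInt pr). split; [|exact Hpr].
    rewrite <- RInt_Reals. apply (RInt_correct f). now apply ex_RInt_Reals_1.
  - destruct Hpr as [Hf Hv].
    exists (ex_RInt_Reals_0 f a b (ex_intro _ pr Hf)).
    rewrite <- RInt_Reals. now rewrite (is_RInt_unique f a b pr Hf).
Qed.

Lemma improper_int_R_unique (f : R -> R) (v w : R) :
  improper_int_R f v -> improper_int_R f w -> v = w.
Proof.
  rewrite !improper_int_R_iff. intros Hv Hw. apply cond_eq. intros eps He.
  destruct (Hv (eps / 2)) as [M HM]; [lra|].
  destruct (Hw (eps / 2)) as [N HN]; [lra|].
  pose proof (Rmax_l M N). pose proof (Rmax_r M N).
  destruct (HM (- Rmax M N) (Rmax M N)) as [I [HI HIv]]; [lra|lra|].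
  destruct (HN (- Rmax M N) (Rmax M N)) as [J [HJ HJw]]; [lra|lra|].
  rewrite <- (is_RInt_unique _ _ _ _ HI), (is_RInt_unique _ _ _ _ HJ) in HIv.
  apply Rabs_def2 in HIv. apply Rabs_def2 in HJw. apply Rabs_def1; lra.
Qed.

Lemma int_R_eq (f : R -> R) (v : R) : improper_int_R f v -> int_R f = v.
Proof.
  intros H. apply (improper_int_R_unique f); [|exact H].
  unfold int_R. apply epsilon_spec. now exists v.
Qed.

Lemma improper_int_R_ext (f g : R -> R) (v : R) :
  (forall x, f x = g x) -> improper_int_R f v -> improper_int_R g v.
Proof. intros H. now replace g with f by now apply functional_extensionality. Qed.

Lemma improper_int_R_opp (f : R -> R) (v : R) :
  improper_int_R f v -> improper_int_R (fun x => f (- x)) v.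
Proof.
  rewrite !improper_int_R_iff. intros H eps He. destruct (H eps He) as [M HM].
  exists M. intros a b Ha Hb. destruct (HM (- b) (- a)) as [I [HI Hv]]; [lra|lra|].
  exists I. split; [|exact Hv].
  apply (is_RInt_ext (fun y => opp (opp (f (- y))))).
  { intros y _. apply Ropp_involutive. }
  replace I with (opp (opp I)) by apply Ropp_involutive.
  apply (is_RInt_opp (fun y => opp (f (- y)))).
  apply (is_RInt_comp_opp f). now apply is_RInt_swap.
Qed.

(* No integrability is assumed: the two sets of possible values coincide, so
   the choice operator returns the same value. *)
Lemma int_R_opp (f : R -> R) : int_R (fun x => f (- x)) = int_R f.
Proof.
  unfold int_R. f_equal. apply functional_extensionality. intros v.
  apply propositional_extensionality. split; intros H.
  - apply improper_int_R_opp in H. revert H. apply improper_int_R_ext.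
    intros x. now rewrite Ropp_involutive.
  - now apply improper_int_R_opp.
Qed.

Lemma improper_int_R_affine (f : R -> R) (v k m : R) :
  0 < k -> improper_int_R f v -> improper_int_R (fun x => k * f (k * x + m)) v.
Proof.
  intros Hk. rewrite !improper_int_R_iff. intros H eps He.
  destruct (H eps He) as [M HM]. exists ((M + Rabs m) / k). intros a b Ha Hb.
  pose proof (Rle_abs m). pose proof (Rle_abs (- m)) as Hm. rewrite Rabs_Ropp in Hm.
  assert (E : k * ((M + Rabs m) / k) = M + Rabs m) by (field; lra).
  destruct (HM (k * a + m) (k * b + m)) as [I [HI Hv]]; [nra|nra|].
  exists I. split; [|exact Hv]. now apply (is_RInt_comp_lin f k m).
Qed.

Lemma improper_int_R_scal (f : R -> R) (v c : R) :
  improper_int_R f v -> improper_int_R (fun x => c * f x) (c * v).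
Proof.
  rewrite !improper_int_R_iff. intros H eps He. pose proof (Rabs_pos c) as Hc.
  destruct (H (eps / (Rabs c + 1))) as [M HM]; [apply Rdiv_lt_0_compat; lra|].
  exists M. intros a b Ha Hb. destruct (HM a b Ha Hb) as [I [HI Hv]].
  exists (c * I). split; [now apply (is_RInt_scal f)|].
  rewrite <- Rmult_minus_distr_l, Rabs_mult.
  pose proof (Rabs_pos (I - v)).
  assert (E : eps / (Rabs c + 1) * (Rabs c + 1) = eps) by (field; lra).
  nra.
Qed.

Lemma improper_int_R_plus (f g : R -> R) (v w : R) :
  improper_int_R f v -> improper_int_R g w -> improper_int_R (fun x => f x + g x) (v + w).
Proof.
  rewrite !improper_int_R_iff. intros Hv Hw eps He.
  destruct (Hv (eps / 2)) as [M HM]; [lra|].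
  destruct (Hw (eps / 2)) as [N HN]; [lra|].
  exists (Rmax M N). intros a b Ha Hb.
  pose proof (Rmax_l M N). pose proof (Rmax_r M N).
  destruct (HM a b) as [I [HI HIv]]; [lra|lra|].
  destruct (HN a b) as [J [HJ HJw]]; [lra|lra|].
  exists (I + J). split; [now apply (is_RInt_plus f g)|].
  replace (I + J - (v + w)) with ((I - v) + (J - w)) by ring.
  eapply Rle_lt_trans; [apply Rabs_triang|lra].
Qed.

Lemma improper_int_R_gauss_below (f : R -> R) (L : R) :
  (forall t, t < L -> f t = gauss t) -> (forall t, L < t -> f t = 0) ->
  improper_int_R f (half_mass + gaussI L).
Proof.
  intros H1 H2. apply improper_int_R_iff. intros eps He.
  destruct (gaussI_lim eps He) as [T [HT HTl]].
  exists (Rmax T (Rabs L)). intros a b Ha Hb.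
  pose proof (Rmax_l T (Rabs L)). pose proof (Rmax_r T (Rabs L)).
  pose proof (Rle_abs L). pose proof (Rle_abs (- L)) as HL. rewrite Rabs_Ropp in HL.
  exists (gaussI L - gaussI a + 0). split.
  - apply (is_RInt_Chasles f a L b).
    + apply (is_RInt_ext gauss); [|apply is_RInt_gauss].
      intros x. rewrite Rmin_left, Rmax_right by lra. intros Hx. symmetry. now apply H1.
    + apply (is_RInt_ext (fun _ => 0)).
      { intros x. rewrite Rmin_left, Rmax_right by lra. intros Hx. symmetry. now apply H2. }
      pose proof (is_RInt_const (V := R_NormedModule) L b 0) as Hz.
      change (is_RInt (fun _ => 0) L b ((b - L) * 0)) in Hz.
      now rewrite Rmult_0_r in Hz.
  - pose proof (HTl (- a)). pose proof (gaussI_le (- a)). rewrite gaussI_opp in *.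
    apply Rabs_def1; lra.
Qed.

Lemma improper_int_R_gauss : improper_int_R gauss (2 * half_mass).
Proof.
  apply improper_int_R_iff. intros eps He.
  destruct (gaussI_lim (eps / 2)) as [T [HT HTl]]; [lra|].
  exists T. intros a b Ha Hb. exists (gaussI b - gaussI a).
  split; [apply is_RInt_gauss|].
  pose proof (HTl (- a)). pose proof (HTl b). pose proof (gaussI_le (- a)).
  pose proof (gaussI_le b). rewrite gaussI_opp in *.
  apply Rabs_def1; lra.
Qed.

Lemma is_derive_gaussI_comp (f : R -> R) (x l : R) :
  is_derive f x l -> is_derive (fun x => gaussI (f x)) x (gauss (f x) * l).
Proof.
  intros H. rewrite Rmult_comm.
  apply (is_derive_comp gaussI f x (gauss (f x)) l); [apply is_derive_gaussI|exact H].
Qed.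

Section Convolution.

Variable be : R.

Let om : R := sqrt (1 + be ^ 2).

Lemma om_sqr : om ^ 2 = 1 + be ^ 2.
Proof. apply pow2_sqrt. nra. Qed.

Lemma om_ge_1 : 1 <= om.
Proof.
  unfold om. rewrite <- sqrt_1 at 1. apply sqrt_le_1_alt. nra.
Qed.

Let E (a b al : R) : R := RInt (fun w => gauss w * gaussI (al + be * w)) a b.

Lemma ex_RInt_conv (a b al : R) : ex_RInt (fun w => gauss w * gaussI (al + be * w)) a b.
Proof.
  apply ex_RInt_of_ex_derive. intros x.
  apply (ex_derive_mult gauss (fun w => gaussI (al + be * w))).
  - unfold gauss. auto_derive. exact I.
  - eexists. apply (is_derive_gaussI_comp (fun w => al + be * w) x be).
    auto_derive; [exact I|ring].
Qed.

Lemma gauss_mul_affine (al w : R) :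
  gauss w * gauss (al + be * w) = gauss (al / om) * gauss (om * w + al * be / om).
Proof.
  pose proof om_ge_1. unfold gauss. rewrite <- !exp_plus. f_equal.
  pose proof om_sqr as B. set (q := al / om).
  replace (al * be / om) with (q * be) by (unfold q; field; lra).
  replace al with (q * om) by (unfold q; field; lra).
  apply Rminus_diag_uniq.
  transitivity ((w ^ 2 - q ^ 2) * (om ^ 2 - (1 + be ^ 2)) / 2); [field|].
  rewrite B. field.
Qed.

Lemma is_derive_conv (a b al : R) :
  is_derive (E a b) al
    (gauss (al / om) / om * (gaussI (om * b + al * be / om) - gaussI (om * a + al * be / om))).
Proof.
  pose proof om_ge_1 as Hom.
  assert (D : forall u w, is_derive (fun u => gauss w * gaussI (u + be * w)) u
                (gauss w * gauss (u + be * w))).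
  { intros u w. apply (is_derive_scal (fun u => gaussI (u + be * w))).
    rewrite <- (Rmult_1_r (gauss (u + be * w))).
    apply (is_derive_gaussI_comp (fun u => u + be * w)).
    auto_derive; [exact I|ring]. }
  replace (gauss (al / om) / om * _)
    with (RInt (fun w => Derive (fun u => gauss w * gaussI (u + be * w)) al) a b).
  - apply is_derive_RInt_param.
    + apply filter_forall. intros u w _. eexists; apply D.
    + intros w _.
      apply (continuity_2d_pt_ext (fun u v => gauss v * gauss (u + be * v))).
      { intros u v. symmetry. apply is_derive_unique, D. }
      assert (Hc : forall x, continuity_pt gauss x).
      { intros x. apply continuity_pt_filterlim, continuous_gauss. }
      apply continuity_2d_pt_mult.
      * apply (continuity_1d_2d_pt_comp gauss (fun u v => v)); [apply Hc|].
        apply continuity_2d_pt_id2.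
      * apply (continuity_1d_2d_pt_comp gauss (fun u v => u + be * v)); [apply Hc|].
        apply continuity_2d_pt_plus; [apply continuity_2d_pt_id1|].
        apply continuity_2d_pt_mult; [apply continuity_2d_pt_const|apply continuity_2d_pt_id2].
    + apply filter_forall. intros u. apply ex_RInt_conv.
  - apply (is_RInt_unique (V := R_CompleteNormedModule)).
    apply (is_RInt_ext (fun w => scal (gauss (al / om) / om)
      (scal om (gauss (om * w + al * be / om))))).
    + intros w _. symmetry. etransitivity; [apply is_derive_unique, D|].
      change (gauss w * gauss (al + be * w) =
        gauss (al / om) / om * (om * gauss (om * w + al * be / om))).
      rewrite gauss_mul_affine. field. lra.
    + apply (is_RInt_scal (fun w => scal om (gauss (om * w + al * be / om)))).
      apply (is_RInt_comp_lin gauss om (al * be / om)). apply is_RInt_gauss.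
Qed.

Lemma conv_at_0 (a b : R) : E a b 0 = E (- a) b 0.
Proof.
  unfold E.
  assert (Z : is_RInt (fun w => gauss w * gaussI (0 + be * w)) a (- a) 0).
  { pose proof (RInt_correct _ _ _ (ex_RInt_conv a (- a) 0)) as H.
    set (I := RInt _ _ _) in H.
    enough (E0 : I = - I).
    { assert (E1 : I = 0) by (change R in (type of I); lra). now rewrite E1 in H. }
    unfold I at 1. apply (is_RInt_unique (V := R_CompleteNormedModule)).
    apply (is_RInt_ext (fun w => opp (gauss (- w) * gaussI (0 + be * - w)))).
    { intros w _. rewrite gauss_opp.
      replace (0 + be * - w) with (- (0 + be * w)) by ring. rewrite gaussI_opp.
      change (- (gauss w * - gaussI (0 + be * w)) = gauss w * gaussI (0 + be * w)). ring. }
    apply (is_RInt_comp_opp (fun w => gauss w * gaussI (0 + be * w))).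
    rewrite Ropp_involutive. apply (is_RInt_swap _ _ _ _ H). }
  apply (is_RInt_unique (V := R_CompleteNormedModule)).
  replace (RInt (fun w => gauss w * gaussI (0 + be * w)) (- a) b)
    with (plus 0 (RInt (fun w => gauss w * gaussI (0 + be * w)) (- a) b))
    by apply Rplus_0_l.
  apply (is_RInt_Chasles (V := R_NormedModule) _ a (- a) b); [exact Z|].
  apply (RInt_correct (fun w => gauss w * gaussI (0 + be * w))), ex_RInt_conv.
Qed.

Lemma conv_le (a b al : R) : a <= b -> Rabs (E a b al) <= half_mass * (gaussI b - gaussI a).
Proof.
  intros Hab. unfold E.
  eapply Rle_trans; [apply (abs_RInt_le _ a b Hab), ex_RInt_conv|].
  assert (H : is_RInt (fun w => half_mass * gauss w) a b (half_mass * (gaussI b - gaussI a)))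
    by apply (is_RInt_scal gauss), is_RInt_gauss.
  rewrite <- (is_RInt_unique _ _ _ _ H).
  apply RInt_le; [exact Hab| |eexists; exact H|].
  - apply (ex_RInt_ext (fun w => gauss w * Rabs (gaussI (al + be * w)))).
    { intros w _. rewrite Rabs_mult, (Rabs_pos_eq (gauss w)); [easy|].
      apply Rlt_le, gauss_pos. }
    apply (ex_RInt_continuous (V := R_CompleteNormedModule)). intros w _.
    apply (continuous_mult gauss); [apply continuous_gauss|].
    apply (continuous_comp (fun w => gaussI (al + be * w)) Rabs); [|apply continuous_Rabs].
    apply continuous_of_ex_derive. eexists.
    apply (is_derive_gaussI_comp (fun w => al + be * w) w be).
    auto_derive; [exact I|ring].
  - intros w _. rewrite Rabs_mult, (Rabs_pos_eq (gauss w)) by apply Rlt_le, gauss_pos.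
    pose proof (gaussI_abs (al + be * w)). pose proof (gauss_pos w). nra.
Qed.

Lemma conv_at_0_small (a b T eps : R) :
  (forall t, T <= t -> half_mass - eps < gaussI t) -> T <= - a -> T <= b ->
  Rabs (E a b 0) <= half_mass * eps.
Proof.
  intros HT Ha Hb. rewrite conv_at_0.
  pose proof (HT (- a) Ha). pose proof (HT b Hb).
  pose proof (gaussI_le (- a)). pose proof (gaussI_le b). pose proof half_mass_pos.
  destruct (Rle_dec (- a) b) as [H'|H'].
  - eapply Rle_trans; [apply (conv_le _ _ _ H')|]. apply Rmult_le_compat_l; lra.
  - unfold E. rewrite <- (opp_RInt_swap (V := R_CompleteNormedModule)); [|apply ex_RInt_conv].
    change (Rabs (- E b (- a) 0) <= half_mass * eps). rewrite Rabs_Ropp.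
    eapply Rle_trans; [apply conv_le; lra|]. apply Rmult_le_compat_l; lra.
Qed.

Lemma improper_int_R_conv (al : R) :
  improper_int_R (fun w => gauss w * gaussI (al + be * w))
    (2 * half_mass * gaussI (al / sqrt (1 + be ^ 2))).
Proof.
  pose proof om_ge_1 as Hom. pose proof half_mass_pos as Hm.
  fold om. apply improper_int_R_iff. intros eps He.
  set (eps' := eps / (2 * (half_mass + 2 * Rabs al))).
  pose proof (Rabs_pos al) as Hal.
  assert (He' : 0 < eps') by (apply Rdiv_lt_0_compat; lra).
  destruct (gaussI_lim eps' He') as [T [HT HTl]].
  exists (T + Rabs (al * be)). intros a b Ha Hb.
  pose proof (Rabs_pos (al * be)) as Hab.
  exists (E a b al). split.
  { apply (RInt_correct (fun w => gauss w * gaussI (al + be * w))), ex_RInt_conv. }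
  destruct (MVT_gen (fun x => E a b x - 2 * half_mass * gaussI (x / om)) 0 al
    (fun x => gauss (x / om) / om *
      (gaussI (om * b + x * be / om) - gaussI (om * a + x * be / om) - 2 * half_mass)))
    as [c [Hc Ec]].
  - intros x _.
    assert (D : is_derive (fun x => 2 * half_mass * gaussI (x / om)) x
                  (2 * half_mass * (gauss (x / om) * / om))).
    { apply (is_derive_scal (fun x => gaussI (x / om))).
      apply (is_derive_gaussI_comp (fun x => x / om)). auto_derive; [lra|field; lra]. }
    pose proof (is_derive_minus (E a b) _ x _ _ (is_derive_conv a b x) D) as D'.
    match type of D' with is_derive _ _ ?l => 
      match goal with |- is_derive _ _ ?r => replace r with l; [exact D'|] end end.
    match goal with |- minus ?p ?q = ?r => change (@eq R (p - q) r) end.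
    field. lra.
  - intros x _. apply continuity_pt_filterlim.
    apply (continuous_of_ex_derive (fun x => E a b x - 2 * half_mass * gaussI (x / om))).
    apply (ex_derive_minus (E a b) (fun x => 2 * half_mass * gaussI (x / om))).
    + eexists; apply is_derive_conv.
    + apply (ex_derive_scal (fun x => gaussI (x / om))).
      eexists. apply (is_derive_gaussI_comp (fun x => x / om) x (/ om)).
      auto_derive; [lra|field; lra].
  - assert (B : Rabs (c * be / om) <= Rabs (al * be)).
    { unfold Rdiv. rewrite !Rabs_mult.
      assert (Rabs c <= Rabs al).
      { revert Hc. unfold Rmin, Rmax. destruct (Rle_dec 0 al); intros Hc.
        - rewrite !Rabs_pos_eq by lra. lra.
        - rewrite !Rabs_left1 by lra. lra. }
      assert (0 < / om <= 1).
      { split; [apply Rinv_0_lt_compat; lra|]. rewrite <- Rinv_1.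
        apply Rinv_le_contravar; lra. }
      rewrite (Rabs_pos_eq (/ om)) by lra.
      pose proof (Rabs_pos be). pose proof (Rabs_pos c).
      assert (Rabs c * Rabs be <= Rabs al * Rabs be) by nra.
      assert (0 <= Rabs c * Rabs be) by nra. nra. }
    apply Rabs_le_between in B.
    set (d := gaussI (om * b + c * be / om) - gaussI (om * a + c * be / om) - 2 * half_mass) in Ec.
    assert (Hd : Rabs d <= 2 * eps').
    { pose proof (HTl (om * b + c * be / om)) as P1.
      pose proof (HTl (- (om * a + c * be / om))) as P2.
      pose proof (gaussI_le (om * b + c * be / om)).
      pose proof (gaussI_le (- (om * a + c * be / om))).
      rewrite gaussI_opp in *.
      assert (b <= om * b) by nra. assert (om * a <= a) by nra.
      specialize (P1 ltac:(lra)). specialize (P2 ltac:(lra)).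
      apply Rabs_le. unfold d. lra. }
    assert (Hg : 0 <= gauss (c / om) / om <= 1).
    { pose proof (gauss_pos (c / om)). pose proof (gauss_le_1 (c / om)). split.
      - apply Rlt_le, Rdiv_lt_0_compat; lra.
      - apply Rle_div_l; lra. }
    assert (H0 : Rabs (E a b 0) <= half_mass * eps')
      by (apply (conv_at_0_small a b T eps' HTl); lra).
    replace (E a b al - 2 * half_mass * gaussI (al / om))
      with (E a b 0 + gauss (c / om) / om * d * al).
    2:{ replace (0 / om) with 0 in Ec by (field; lra). rewrite gaussI_0 in Ec.
        unfold Rminus in *. nra. }
    apply Rle_lt_trans with (half_mass * eps' + 2 * eps' * Rabs al).
    + eapply Rle_trans; [apply Rabs_triang|]. apply Rplus_le_compat; [exact H0|].
      rewrite !Rabs_mult. apply Rmult_le_compat_r; [exact Hal|].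
      rewrite (Rabs_pos_eq (gauss (c / om) / om)) by lra.
      pose proof (Rabs_pos d). nra.
    + replace (half_mass * eps' + 2 * eps' * Rabs al) with (eps / 2); [lra|].
      unfold eps'. field. lra.
Qed.

End Convolution.

(** * Probability of a half-plane *)

Definition lin_var (sx sy rho u1 u2 : R) : R :=
  sx ^ 2 * u1 ^ 2 + 2 * rho * sx * sy * u1 * u2 + sy ^ 2 * u2 ^ 2.

Definition normal_cdf (z : R) : R := 1 / 2 + gaussI z / (2 * half_mass).

Lemma normal_cdf_opp (z : R) : normal_cdf (- z) = 1 - normal_cdf z.
Proof.
  unfold normal_cdf. rewrite gaussI_opp. pose proof half_mass_pos. field. lra.
Qed.

Lemma one_minus_sqr_pos (rho : R) : -1 < rho -> rho < 1 -> 0 < 1 - rho ^ 2.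
Proof. intros. nra. Qed.

Lemma binorm_density_eq (sx sy rho x y : R) :
  0 < sx -> 0 < sy -> -1 < rho -> rho < 1 ->
  binorm_density sx sy rho x y =
  / (2 * PI * sx * sy * sqrt (1 - rho ^ 2)) * gauss (/ sx * x + 0) *
  gauss (/ (sy * sqrt (1 - rho ^ 2)) * y + - (rho * x) / (sx * sqrt (1 - rho ^ 2))).
Proof.
  intros Hx Hy H1 H2. pose proof (one_minus_sqr_pos rho H1 H2) as Hr.
  unfold binorm_density. rewrite (Rmult_assoc _ (gauss (/ sx * x + 0))). f_equal.
  unfold gauss. rewrite <- exp_plus. f_equal.
  pose proof (sqrt_lt_R0 _ Hr) as Hk.
  pose proof (pow2_sqrt (1 - rho ^ 2) ltac:(lra)) as Hk2.
  set (k := sqrt (1 - rho ^ 2)) in *. rewrite <- Hk2.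
  replace (/ (sy * k) * y + - (rho * x) / (sx * k))
    with ((y / sy - rho * x / sx) / k) by (field; lra).
  replace (/ sx * x + 0) with (x / sx) by (field; lra).
  apply Rminus_diag_uniq.
  transitivity ((x / sx) ^ 2 * (k ^ 2 - (1 - rho ^ 2)) / (2 * k ^ 2)); [field; lra|].
  rewrite Hk2. field. lra.
Qed.

Lemma binorm_density_opp (sx sy rho x y : R) :
  binorm_density sx sy rho (- x) (- y) = binorm_density sx sy rho x y.
Proof. unfold binorm_density, Rdiv. do 2 f_equal. ring. Qed.

Lemma binorm_prob_opp (sx sy rho : R) (C : R -> R -> Prop) :
  binorm_prob sx sy rho (fun x y => C (- x) (- y)) = binorm_prob sx sy rho C.
Proof.
  unfold binorm_prob.
  rewrite <- (int_R_opp (fun x => int_R (fun y => binorm_density sx sy rho x y * indic C x y))).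
  f_equal. apply functional_extensionality. intros x.
  rewrite <- (int_R_opp (fun y => binorm_density sx sy rho (- x) y * indic C (- x) y)).
  f_equal. apply functional_extensionality. intros y.
  now rewrite binorm_density_opp.
Qed.

Lemma indic_true (C : R -> R -> Prop) (x y : R) : C x y -> indic C x y = 1.
Proof.
  intros H. unfold indic. now destruct (excluded_middle_informative (C x y)).
Qed.

Lemma indic_false (C : R -> R -> Prop) (x y : R) : ~ C x y -> indic C x y = 0.
Proof.
  intros H. unfold indic. now destruct (excluded_middle_informative (C x y)).
Qed.

Lemma binorm_prob_halfplane (sx sy rho u1 u2 c : R) (C : R -> R -> Prop) :
  0 < sx -> 0 < sy -> -1 < rho -> rho < 1 -> 0 < u2 ->
  (forall x y, C x y <-> u1 * x + u2 * y < c) ->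
  binorm_prob sx sy rho C = normal_cdf (c / sqrt (lin_var sx sy rho u1 u2)).
Proof.
  intros Hx Hy H1 H2 Hu HC.
  pose proof (one_minus_sqr_pos rho H1 H2) as Hr.
  pose proof (sqrt_lt_R0 _ Hr) as Hk.
  pose proof (pow2_sqrt (1 - rho ^ 2) ltac:(lra)) as Hk2.
  set (k := sqrt (1 - rho ^ 2)) in *.
  set (al := c / (u2 * sy * k)).
  set (be := - (u1 * sx + rho * (u2 * sy)) / (u2 * sy * k)).
  pose proof half_mass_pos as Hm. pose proof half_mass_sqr as Hm2.
  pose proof PI_RGT_0 as Hpi.
  set (w := sqrt (lin_var sx sy rho u1 u2)).
  assert (Hus : 0 < u2 * sy) by nra. assert (Husk : 0 < u2 * sy * k) by nra.
  assert (Ew : sqrt (1 + be ^ 2) = w / (u2 * sy * k)).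
  { replace (1 + be ^ 2) with (lin_var sx sy rho u1 u2 / (u2 * sy * k) ^ 2).
    - rewrite sqrt_div_alt by (apply pow_lt; lra).
      rewrite sqrt_pow2 by lra. reflexivity.
    - apply Rminus_diag_uniq.
      transitivity ((u2 * sy) ^ 2 * ((1 - rho ^ 2) - k ^ 2) / (u2 * sy * k) ^ 2).
      + unfold be, lin_var. field. lra.
      + rewrite Hk2. field. lra. }
  assert (Hw : 0 < w).
  { assert (0 < w / (u2 * sy * k)).
    { rewrite <- Ew. apply sqrt_lt_R0. nra. }
    replace w with (w / (u2 * sy * k) * (u2 * sy * k)) by (field; lra). nra. }
  assert (Inner : forall x, int_R (fun y => binorm_density sx sy rho x y * indic C x y) =
    / sx * (/ (2 * PI) * (half_mass * gauss (/ sx * x + 0) +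
       gauss (/ sx * x + 0) * gaussI (al + be * (/ sx * x + 0))))).
  { intros x. apply int_R_eq.
    set (m := - (rho * x) / (sx * k)).
    set (L := al + be * (/ sx * x + 0)).
    set (q := fun t => if Rlt_dec t L then gauss t else 0).
    assert (Hq : improper_int_R q (half_mass + gaussI L)).
    { apply improper_int_R_gauss_below; intros t Ht; unfold q;
        destruct (Rlt_dec t L); try easy; lra. }
    assert (Hky : 0 < / (sy * k)) by (apply Rinv_0_lt_compat; nra).
    apply (improper_int_R_affine _ _ (/ (sy * k)) m Hky) in Hq.
    apply (improper_int_R_scal _ _ (/ (2 * PI * sx) * gauss (/ sx * x + 0))) in Hq.
    replace (/ sx * (/ (2 * PI) * (half_mass * gauss (/ sx * x + 0) +
       gauss (/ sx * x + 0) * gaussI L)))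
      with (/ (2 * PI * sx) * gauss (/ sx * x + 0) * (half_mass + gaussI L))
      by (field; lra).
    revert Hq. apply improper_int_R_ext. intros y.
    rewrite binorm_density_eq by assumption. fold k m.
    assert (EL : u2 * (sy * k) * (L - (/ (sy * k) * y + m)) = c - (u1 * x + u2 * y)).
    { unfold L, al, be, m. field. lra. }
    assert (Hs : 0 < u2 * (sy * k)) by nra.
    unfold q. destruct (Rlt_dec (/ (sy * k) * y + m) L) as [Hl|Hl].
    - rewrite indic_true by (apply HC; nra). field. lra.
    - rewrite indic_false by (rewrite HC; nra). ring. }
  unfold binorm_prob.
  replace (fun x => int_R (fun y => binorm_density sx sy rho x y * indic C x y))
    with (fun x => / sx * (/ (2 * PI) * (half_mass * gauss (/ sx * x + 0) +
       gauss (/ sx * x + 0) * gaussI (al + be * (/ sx * x + 0)))))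
    by (apply functional_extensionality; intros x; symmetry; apply Inner).
  apply int_R_eq.
  replace (normal_cdf (c / w)) with (/ (2 * PI) * (half_mass * (2 * half_mass) +
    2 * half_mass * gaussI (al / sqrt (1 + be ^ 2)))).
  - apply (improper_int_R_affine (fun t => / (2 * PI) * (half_mass * gauss t +
       gauss t * gaussI (al + be * t)))); [now apply Rinv_0_lt_compat|].
    apply improper_int_R_scal.
    apply (improper_int_R_plus (fun t => half_mass * gauss t)).
    + apply improper_int_R_scal, improper_int_R_gauss.
    + apply improper_int_R_conv.
  - rewrite Ew. replace (al / (w / (u2 * sy * k))) with (c / w)
      by (unfold al; field; lra).
    replace PI with (2 * half_mass ^ 2) by lra.
    unfold normal_cdf. field. lra.
Qed.

Lemma K_eq (sx sy rho x1 y1 x2 y2 : R) :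
  0 < sx -> 0 < sy -> -1 < rho -> rho < 1 -> y1 < y2 ->
  K sx sy rho x1 y1 x2 y2 =
  x2 + y2 - (x2 + y2 - (x1 + y1)) *
    normal_cdf ((x2 ^ 2 + y2 ^ 2 - x1 ^ 2 - y1 ^ 2) / 2 /
      sqrt (lin_var sx sy rho (x2 - x1) (y2 - y1))).
Proof.
  intros Hx Hy H1 H2 Hlt. unfold K.
  destruct (excluded_middle_informative (x1 = x2 /\ y1 = y2)) as [[_ E]|_]; [lra|].
  rewrite (binorm_prob_halfplane sx sy rho (x2 - x1) (y2 - y1)
    ((x2 ^ 2 + y2 ^ 2 - x1 ^ 2 - y1 ^ 2) / 2) (Defs.C1 x1 y1 x2 y2)); try lra.
  2:{ intros x y. unfold Defs.C1. lra. }
  rewrite <- (binorm_prob_opp sx sy rho (Defs.C2 x1 y1 x2 y2)).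
  rewrite (binorm_prob_halfplane sx sy rho (x2 - x1) (y2 - y1)
    (- ((x2 ^ 2 + y2 ^ 2 - x1 ^ 2 - y1 ^ 2) / 2))); try lra.
  2:{ intros x y. unfold Defs.C2. lra. }
  rewrite Rdiv_opp_l, normal_cdf_opp. ring.
Qed.

Lemma K_swap_opp (sx sy rho x1 y1 x2 y2 : R) :
  0 < sx -> 0 < sy -> -1 < rho -> rho < 1 -> y1 < y2 ->
  K sx sy rho (- x2) (- y2) (- x1) (- y1) = - K sx sy rho x1 y1 x2 y2.
Proof.
  intros Hx Hy H1 H2 Hlt. rewrite !K_eq by lra.
  replace (- x1 - - x2) with (x2 - x1) by ring.
  replace (- y1 - - y2) with (y2 - y1) by ring.
  replace (((- x1) ^ 2 + (- y1) ^ 2 - (- x2) ^ 2 - (- y2) ^ 2) / 2)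
    with (- ((x2 ^ 2 + y2 ^ 2 - x1 ^ 2 - y1 ^ 2) / 2)) by field.
  rewrite Rdiv_opp_l, normal_cdf_opp. ring.
Qed.

(** * Local expansion of the payoff *)

Lemma sum_var_pos (sx sy rho : R) :
  0 < sx -> 0 < sy -> -1 < rho -> 0 < sx ^ 2 + 2 * rho * sx * sy + sy ^ 2.
Proof.
  intros Hx Hy H1. assert (0 < sx * sy) by nra.
  assert (0 < (1 + rho) * (sx * sy)) by nra.
  pose proof (pow2_ge_0 (sx - sy)). nra.
Qed.

Lemma xstar_eq (sx sy rho : R) :
  2 * xstar sx sy rho = half_mass * sqrt (sx ^ 2 + 2 * rho * sx * sy + sy ^ 2).
Proof.
  unfold xstar, half_mass. rewrite sqrt_mult_alt; [field|].
  pose proof PI_RGT_0. lra.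
Qed.

Lemma Rabs_linear_le (a b h k r : R) :
  Rabs h <= r -> Rabs k <= r -> Rabs (a * h + b * k) <= (Rabs a + Rabs b) * r.
Proof.
  intros Hh Hk. eapply Rle_trans; [apply Rabs_triang|]. rewrite !Rabs_mult.
  pose proof (Rabs_pos a). pose proof (Rabs_pos b). nra.
Qed.

Lemma lin_var_bounds (sx sy rho h k : R) :
  0 < sx -> 0 < sy -> -1 < rho -> rho < 1 ->
  0 <= lin_var sx sy rho h k <= (sx ^ 2 + sy ^ 2) * 2 * (h ^ 2 + k ^ 2).
Proof.
  intros Hx Hy H1 H2. set (x := sx * h). set (y := sy * k).
  assert (E : lin_var sx sy rho h k = x ^ 2 + 2 * rho * (x * y) + y ^ 2)
    by (unfold lin_var, x, y; ring).
  assert (B : lin_var sx sy rho h k =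
    (1 + rho) / 2 * (x + y) ^ 2 + (1 - rho) / 2 * (x - y) ^ 2) by (rewrite E; field).
  pose proof (pow2_ge_0 (x + y)). pose proof (pow2_ge_0 (x - y)).
  split; [rewrite B; nra|].
  assert (lin_var sx sy rho h k <= 2 * (x ^ 2 + y ^ 2)) by (rewrite B; nra).
  assert (x ^ 2 + y ^ 2 <= (sx ^ 2 + sy ^ 2) * (h ^ 2 + k ^ 2)).
  { assert (E2 : (sx ^ 2 + sy ^ 2) * (h ^ 2 + k ^ 2) - (x ^ 2 + y ^ 2)
      = (sx * k) ^ 2 + (sy * h) ^ 2) by (unfold x, y; ring).
    pose proof (pow2_ge_0 (sx * k)). pose proof (pow2_ge_0 (sy * h)). lra. }
  lra.
Qed.

Lemma sqrt_tangent (s tau l q0 r C : R) :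
  0 < s -> 0 < tau -> Rabs l <= 3 / 4 * (s * tau ^ 2) -> 0 <= q0 <= C * r ^ 2 ->
  let sg := sqrt (4 * s ^ 2 * tau ^ 2 + 4 * s * l + q0) in
  s * tau <= sg /\
  Rabs (sg - (2 * s * tau + l / tau)) <= (C * r ^ 2 + l ^ 2 / tau ^ 2) / (s * tau).
Proof.
  intros Hs Ht Hl Hq sg. apply Rabs_le_between in Hl.
  assert (Hst : 0 < s * tau) by nra.
  set (q := 4 * s ^ 2 * tau ^ 2 + 4 * s * l + q0) in *.
  assert (Hq1 : (s * tau) ^ 2 <= q).
  { unfold q. assert (4 * s * (- (3 / 4 * (s * tau ^ 2))) <= 4 * s * l)
      by (apply Rmult_le_compat_l; lra). lra. }
  assert (Hsg : s * tau <= sg).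
  { unfold sg. rewrite <- (sqrt_pow2 (s * tau)) by lra. now apply sqrt_le_1_alt. }
  split; [exact Hsg|].
  assert (Hsg2 : sg ^ 2 = q) by (apply pow2_sqrt; pose proof (pow2_ge_0 (s * tau)); lra).
  assert (Hlt : l / tau * tau = l) by (field; lra).
  set (y := l / tau) in *.
  replace (l ^ 2 / tau ^ 2) with (y ^ 2) by (unfold y; field; lra).
  assert (Hy : 0 <= 2 * s * tau + y).
  { apply Rmult_le_reg_r with tau; [exact Ht|]. nra. }
  assert (E : (sg - (2 * s * tau + y)) * (sg + (2 * s * tau + y)) = q0 - y ^ 2).
  { transitivity (sg ^ 2 - (2 * s * tau + y) ^ 2); [ring|]. rewrite Hsg2. unfold q.
    rewrite <- Hlt at 1. ring. }
  apply Rle_div_r; [exact Hst|].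
  apply Rle_trans with (Rabs (sg - (2 * s * tau + y)) * (sg + (2 * s * tau + y))).
  { apply Rmult_le_compat_l; [apply Rabs_pos|lra]. }
  rewrite <- (Rabs_pos_eq (sg + (2 * s * tau + y))) by lra.
  rewrite <- Rabs_mult, E. pose proof (pow2_ge_0 y). apply Rabs_le. lra.
Qed.

Definition hess (alpha h k : R) : R :=
  (3 / 2 - alpha) * h ^ 2 + (1 / 2 + alpha) * k ^ 2.

(* [alpha = Cov(xi, xi + eta) / Var(xi + eta)]; the mixed term of the
   second-order expansion of [K] cancels. *)
Lemma K_expansion (sx sy rho : R) :
  0 < sx -> 0 < sy -> -1 < rho -> rho < 1 ->
  let s := xstar sx sy rho in
  let V := sx ^ 2 + 2 * rho * sx * sy + sy ^ 2 in
  let alpha := (sx ^ 2 + rho * sx * sy) / V in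
  exists m d C, 0 < m /\ 0 < d /\ 0 < C /\
    forall h k r, 0 <= r -> r < d -> h ^ 2 + k ^ 2 = r ^ 2 -> - s < s + k /\
    exists sg, m <= sg /\
      Rabs (sg * K sx sy rho (- s) (- s) (s + h) (s + k) + 2 * s * hess alpha h k)
      <= C * r ^ 3.
Proof.
  intros Hx Hy H1 H2 s V alpha.
  pose proof (sum_var_pos sx sy rho Hx Hy H1) as HV. fold V in HV.
  pose proof (xstar_eq sx sy rho) as Hs. fold s V in Hs.
  pose proof (sqrt_lt_R0 _ HV) as Ht. pose proof (pow2_sqrt V ltac:(lra)) as Ht2.
  set (tau := sqrt V) in *. pose proof half_mass_pos as Hm.
  assert (Hs0 : 0 < s) by nra. assert (Hst : 0 < s * tau) by nra.
  set (A := sx ^ 2 + rho * sx * sy). set (B := sy ^ 2 + rho * sx * sy).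
  set (L := Rabs A + Rabs B).
  assert (HL : 0 <= L) by (unfold L; pose proof (Rabs_pos A); pose proof (Rabs_pos B); lra).
  set (C0 := (sx ^ 2 + sy ^ 2) * 2).
  set (D := (C0 + L ^ 2 / tau ^ 2) / (s * tau)).
  assert (HD : 0 <= D).
  { unfold D. apply Rle_div_r; [exact Hst|]. rewrite Rmult_0_l. unfold C0.
    assert (0 <= L ^ 2 / tau ^ 2).
    { apply Rle_div_r; [apply pow_lt; lra|]. rewrite Rmult_0_l. apply pow2_ge_0. }
    pose proof (pow2_ge_0 sx). pose proof (pow2_ge_0 sy). lra. }
  set (d0 := 3 / 4 * (s * tau ^ 2) / (L + 1)).
  assert (Hd0 : 0 < d0).
  { apply Rdiv_lt_0_compat; [|lra]. pose proof (pow_lt tau 2 Ht). nra. }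
  assert (Hh : half_mass = 2 * s / tau) by (rewrite Hs; field; lra).
  assert (Hst2 : 0 < 2 * s / tau) by (rewrite <- Hh; exact Hm).
  exists (2 * half_mass * (s * tau)), (Rmin s d0),
    (2 * s / tau * 2 * D + 1 + 162 * s ^ 2 / tau ^ 2).
  assert (HC3 : 0 <= 162 * s ^ 2 / tau ^ 2).
  { apply Rle_div_r; [apply pow_lt; lra|]. pose proof (pow2_ge_0 s). lra. }
  split; [nra|]. split; [now apply Rmin_pos|].
  split. { assert (0 <= 2 * s / tau * 2 * D) by nra. lra. }
  intros h k r Hr0 Hrd Hhk.
  assert (Hrs : r < s) by (pose proof (Rmin_l s d0); lra).
  assert (Hrd0 : r < d0) by (pose proof (Rmin_r s d0); lra).
  assert (Ah : Rabs h <= r).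
  { rewrite <- (Rabs_pos_eq r Hr0). apply Rsqr_le_abs_0. unfold Rsqr. nra. }
  assert (Ak : Rabs k <= r).
  { rewrite <- (Rabs_pos_eq r Hr0). apply Rsqr_le_abs_0. unfold Rsqr. nra. }
  pose proof (proj1 (Rabs_le_between _ _) Ak) as Hk.
  split; [lra|].
  set (l := A * h + B * k). set (q0 := lin_var sx sy rho h k).
  assert (Al : Rabs l <= L * r) by now apply Rabs_linear_le.
  destruct (sqrt_tangent s tau l q0 r C0 Hs0 Ht) as [Hsg Hd].
  { apply Rle_trans with (L * d0); [apply Rle_trans with (1 := Al); nra|].
    replace (3 / 4 * (s * tau ^ 2)) with ((L + 1) * d0) by (unfold d0; field; lra). nra. }
  { unfold C0. rewrite <- Hhk. now apply lin_var_bounds. }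
  set (sg := sqrt _) in Hsg, Hd.
  exists (2 * half_mass * sg). split; [apply Rmult_le_compat_l; lra|].
  rewrite K_eq by lra.
  replace (lin_var sx sy rho (s + h - - s) (s + k - - s))
    with (4 * s ^ 2 * tau ^ 2 + 4 * s * l + q0)
    by (rewrite Ht2; unfold q0, l, A, B, V, lin_var; ring).
  fold sg.
  set (P := h + k).
  replace (((s + h) ^ 2 + (s + k) ^ 2 - (- s) ^ 2 - (- s) ^ 2) / 2)
    with (s * P + r ^ 2 / 2) by (rewrite <- Hhk; unfold P; field).
  set (c := s * P + r ^ 2 / 2). set (z := c / sg).
  replace (s + h + (s + k)) with (2 * s + P) by (unfold P; ring).
  assert (Hz : sg * z = c) by (unfold z; field; lra).
  assert (AP : Rabs P <= 2 * r).
  { unfold P. eapply Rle_trans; [apply Rabs_triang|lra]. }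
  assert (Ac : Rabs c <= 3 * s * r).
  { unfold c. apply Rabs_le_between in AP. apply Rabs_le. nra. }
  assert (Az : Rabs z <= 3 * r / tau).
  { unfold z. unfold Rdiv at 1. rewrite Rabs_mult, Rabs_inv, (Rabs_pos_eq sg) by lra.
    apply Rle_div_l; [lra|]. apply Rle_trans with (1 := Ac).
    replace (3 * s * r) with (3 * r / tau * (s * tau)) by (field; lra).
    apply Rmult_le_compat_l; [|exact Hsg].
    apply Rle_div_r; lra. }
  set (dl := sg - (2 * s * tau + l / tau)) in Hd.
  assert (Adl : Rabs dl <= D * r ^ 2).
  { apply Rle_trans with (1 := Hd). apply Rle_div_l; [exact Hst|].
    replace (D * r ^ 2 * (s * tau)) with (C0 * r ^ 2 + (L * r) ^ 2 / tau ^ 2)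
      by (unfold D; field; lra).
    apply Rplus_le_compat_l. unfold Rdiv. apply Rmult_le_compat_r.
    - apply Rlt_le, Rinv_0_lt_compat, pow_lt, Ht.
    - rewrite <- (pow2_abs l). apply pow_incr. pose proof (Rabs_pos l). lra. }
  set (F := gaussI z). pose proof (gaussI_linear z) as HF. fold F in HF.
  assert (Main : 2 * half_mass * sg * (2 * s + P - (2 * s + P - (- s + - s)) * normal_cdf z)
     + 2 * s * hess alpha h k
     = 2 * s / tau * P * dl - P * r ^ 2 / 2 - (4 * s + P) * (sg * (F - z))).
  { unfold normal_cdf. fold F.
    transitivity (half_mass * P * sg - (4 * s + P) * (sg * z) - (4 * s + P) * (sg * (F - z))
      + 2 * s * hess alpha h k); [field; lra|].
    rewrite Hz, Hh. unfold dl.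
    replace (hess alpha h k) with (r ^ 2 + P ^ 2 / 2 - P * l / V).
    2:{ rewrite <- Hhk. unfold hess, alpha, P, l. fold A.
        replace B with (V - A) by (unfold V, A, B; ring). field. lra. }
    rewrite <- Ht2. unfold c. field. lra. }
  rewrite Main.
  assert (e1 : Rabs (2 * s / tau * P * dl) <= 2 * s / tau * 2 * D * r ^ 3).
  { rewrite !Rabs_mult, (Rabs_pos_eq (2 * s / tau)) by lra.
    replace (2 * s / tau * 2 * D * r ^ 3) with (2 * s / tau * (2 * r) * (D * r ^ 2)) by ring.
    apply Rmult_le_compat; [|apply Rabs_pos| |exact Adl].
    - apply Rmult_le_pos; [lra|apply Rabs_pos].
    - apply Rmult_le_compat_l; lra. }
  assert (e2 : Rabs (P * r ^ 2 / 2) <= r ^ 3).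
  { replace (P * r ^ 2 / 2) with (P * (r ^ 2 / 2)) by field.
    pose proof (pow2_ge_0 r).
    rewrite Rabs_mult, (Rabs_pos_eq (r ^ 2 / 2)) by lra.
    replace (r ^ 3) with (2 * r * (r ^ 2 / 2)) by field.
    apply Rmult_le_compat_r; lra. }
  assert (e3 : Rabs ((4 * s + P) * (sg * (F - z))) <= 162 * s ^ 2 / tau ^ 2 * r ^ 3).
  { rewrite Rabs_mult, (Rabs_mult sg).
    replace (162 * s ^ 2 / tau ^ 2 * r ^ 3)
      with (6 * s * (3 * s * r * (3 * r / tau) ^ 2)) by (field; lra).
    apply Rmult_le_compat; [apply Rabs_pos| | |].
    - apply Rmult_le_pos; apply Rabs_pos.
    - eapply Rle_trans; [apply Rabs_triang|]. rewrite Rabs_pos_eq; lra.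
    - apply Rle_trans with (Rabs sg * Rabs z ^ 3).
      { apply Rmult_le_compat_l; [apply Rabs_pos|exact HF]. }
      replace (Rabs sg * Rabs z ^ 3) with (Rabs (sg * z) * Rabs z ^ 2)
        by (rewrite Rabs_mult; ring).
      rewrite Hz. apply Rmult_le_compat; [apply Rabs_pos|apply pow2_ge_0|exact Ac|].
      apply pow_incr. split; [apply Rabs_pos|exact Az]. }
  replace ((2 * s / tau * 2 * D + 1 + 162 * s ^ 2 / tau ^ 2) * r ^ 3)
    with (2 * s / tau * 2 * D * r ^ 3 + r ^ 3 + 162 * s ^ 2 / tau ^ 2 * r ^ 3) by ring.
  apply Rabs_le_between in e1. apply Rabs_le_between in e2. apply Rabs_le_between in e3.
  apply Rabs_le. lra.
Qed.

Lemma hess_coefs (sx sy rho : R) :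
  0 < sx -> 0 < sy -> -1 < rho ->
  - (sx ^ 2 + 3 * sy ^ 2) / (4 * sx * sy) < rho ->
  - (3 * sx ^ 2 + sy ^ 2) / (4 * sx * sy) < rho ->
  let alpha := (sx ^ 2 + rho * sx * sy) / (sx ^ 2 + 2 * rho * sx * sy + sy ^ 2) in
  0 < 3 / 2 - alpha /\ 0 < 1 / 2 + alpha.
Proof.
  intros Hx Hy H1 HA HB alpha.
  pose proof (sum_var_pos sx sy rho Hx Hy H1) as HV.
  assert (Hxy : 0 < 4 * sx * sy) by nra.
  apply Rlt_div_l in HA; [|exact Hxy]. apply Rlt_div_l in HB; [|exact Hxy].
  unfold alpha. split.
  - replace (3 / 2 - _) with ((sx ^ 2 + 3 * sy ^ 2 + rho * (4 * sx * sy)) / 2 /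
      (sx ^ 2 + 2 * rho * sx * sy + sy ^ 2)) by (field; lra).
    apply Rdiv_lt_0_compat; lra.
  - replace (1 / 2 + _) with ((3 * sx ^ 2 + sy ^ 2 + rho * (4 * sx * sy)) / 2 /
      (sx ^ 2 + 2 * rho * sx * sy + sy ^ 2)) by (field; lra).
    apply Rdiv_lt_0_compat; lra.
Qed.

Lemma K_local (sx sy rho : R) :
  0 < sx -> 0 < sy -> -1 < rho -> rho < 1 ->
  - (sx ^ 2 + 3 * sy ^ 2) / (4 * sx * sy) < rho ->
  - (3 * sx ^ 2 + sy ^ 2) / (4 * sx * sy) < rho ->
  let s := xstar sx sy rho in
  exists d C, 0 < d /\ 0 < C /\ forall h k, h ^ 2 + k ^ 2 < d ^ 2 ->
    - s < s + k /\
    Rabs (K sx sy rho (- s) (- s) (s + h) (s + k)) <= C * (h ^ 2 + k ^ 2) /\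
    (0 < h ^ 2 + k ^ 2 -> K sx sy rho (- s) (- s) (s + h) (s + k) < 0).
Proof.
  intros Hx Hy H1 H2 HA HB s.
  destruct (K_expansion sx sy rho Hx Hy H1 H2) as (m & d & C & Hm & Hd & HC & HK).
  fold s in HK.
  destruct (hess_coefs sx sy rho Hx Hy H1 HA HB) as [Hp1 Hp2].
  set (alpha := _ / _) in HK, Hp1, Hp2.
  assert (Hs : 0 < s).
  { pose proof (xstar_eq sx sy rho) as E. fold s in E. pose proof half_mass_pos.
    pose proof (sqrt_lt_R0 _ (sum_var_pos sx sy rho Hx Hy H1)). nra. }
  set (p := Rmin (3 / 2 - alpha) (1 / 2 + alpha)).
  assert (Hp : 0 < p) by now apply Rmin_pos.
  assert (Hlow : forall h k, p * (h ^ 2 + k ^ 2) <= hess alpha h k).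
  { intros h k. unfold hess.
    pose proof (Rmin_l (3 / 2 - alpha) (1 / 2 + alpha)).
    pose proof (Rmin_r (3 / 2 - alpha) (1 / 2 + alpha)). fold p in H, H0.
    pose proof (pow2_ge_0 h). pose proof (pow2_ge_0 k). nra. }
  assert (Hup : forall h k, hess alpha h k <= 2 * (h ^ 2 + k ^ 2)).
  { intros h k. unfold hess. pose proof (pow2_ge_0 h). pose proof (pow2_ge_0 k). nra. }
  assert (Hq : 0 < 2 * s * p / C) by (apply Rdiv_lt_0_compat; nra).
  exists (Rmin d (2 * s * p / C)), ((4 * s + C * d) / m).
  split; [now apply Rmin_pos|]. split; [apply Rdiv_lt_0_compat; nra|].
  intros h k Hhk.
  set (r := sqrt (h ^ 2 + k ^ 2)).
  assert (Hn : 0 <= h ^ 2 + k ^ 2) by nra.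
  assert (Hr2 : r ^ 2 = h ^ 2 + k ^ 2) by now apply pow2_sqrt.
  assert (Hr0 : 0 <= r) by apply sqrt_pos.
  assert (Hrd : r < Rmin d (2 * s * p / C)).
  { rewrite <- Hr2 in Hhk. pose proof (Rmin_pos d (2 * s * p / C) Hd Hq). nra. }
  pose proof (Rmin_l d (2 * s * p / C)). pose proof (Rmin_r d (2 * s * p / C)).
  destruct (HK h k r Hr0 ltac:(lra) (eq_sym Hr2)) as [Hk [sg [Hsg HE]]].
  split; [exact Hk|].
  specialize (Hlow h k). specialize (Hup h k). rewrite <- Hr2 in Hlow, Hup |- *.
  set (Kv := K _ _ _ _ _ _ _) in *.
  apply Rabs_le_between in HE.
  assert (Hr3 : r ^ 3 = r * r ^ 2) by ring.
  split.
  - replace ((4 * s + C * d) / m * r ^ 2) with ((4 * s + C * d) * r ^ 2 / m) by (field; lra).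
    apply Rle_div_r; [exact Hm|].
    apply Rle_trans with (Rabs Kv * sg); [apply Rmult_le_compat_l; [apply Rabs_pos|lra]|].
    rewrite <- (Rabs_pos_eq sg), <- Rabs_mult by lra.
    assert (C * r ^ 3 <= C * d * r ^ 2).
    { rewrite Hr3, Rmult_assoc. apply Rmult_le_compat_l; [lra|].
      apply Rmult_le_compat_r; lra. }
    assert (2 * s * hess alpha h k <= 4 * s * r ^ 2) by nra.
    assert (0 <= p * r ^ 2) by (pose proof (pow2_ge_0 r); nra).
    assert (0 <= 2 * s * hess alpha h k) by nra.
    apply Rabs_le. lra.
  - intros Hpos.
    assert (C * r < 2 * s * p).
    { replace (2 * s * p) with (C * (2 * s * p / C)) by (field; lra).
      apply Rmult_lt_compat_l; lra. }
    assert (C * r ^ 3 < 2 * s * p * r ^ 2).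
    { rewrite Hr3, <- Rmult_assoc. apply Rmult_lt_compat_r; lra. }
    assert (2 * s * (p * r ^ 2) <= 2 * s * hess alpha h k)
      by (apply Rmult_le_compat_l; lra).
    assert (sg * Kv < 0) by lra. nra.
Qed.

Lemma derivable_pt_lim_quadratic (f : R -> R) (x C d : R) :
  0 < C -> 0 < d -> (forall h, h ^ 2 < d ^ 2 -> Rabs (f (x + h)) <= C * h ^ 2) ->
  derivable_pt_lim f x 0.
Proof.
  intros HC Hd Hf eps He.
  assert (Hq : 0 < eps / C) by now apply Rdiv_lt_0_compat.
  exists (mkposreal _ (Rmin_pos _ _ Hd Hq)). intros h Hh Hlt. simpl in Hlt.
  pose proof (Rmin_l d (eps / C)). pose proof (Rmin_r d (eps / C)).
  pose proof (Rabs_pos_lt h Hh) as Hah.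
  assert (F0 : f x = 0).
  { pose proof (Hf 0 ltac:(nra)) as Z. rewrite Rplus_0_r in Z.
    apply Rabs_eq_0. pose proof (Rabs_pos (f x)). lra. }
  rewrite F0, !Rminus_0_r. unfold Rdiv. rewrite Rabs_mult, Rabs_inv.
  assert (B : Rabs (f (x + h)) <= C * Rabs h ^ 2).
  { rewrite pow2_abs. apply Hf. rewrite <- pow2_abs. nra. }
  apply Rlt_div_l; [exact Hah|].
  assert (C * Rabs h < eps).
  { replace eps with (C * (eps / C)) by (field; lra). apply Rmult_lt_compat_l; lra. }
  nra.
Qed.

Theorem mainTheorem7 (sx sy rho : R)
  (hsx : 0 < sx) (hsy : 0 < sy) (hr1 : -1 < rho) (hr2 : rho < 1)
  (hA : - (sx ^ 2 + 3 * sy ^ 2) / (4 * sx * sy) < rho)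
  (hB : - (3 * sx ^ 2 + sy ^ 2) / (4 * sx * sy) < rho) :
  let x2s := xstar sx sy rho in
  (* vanishing first-order partial derivatives at a_star = (-x2s,-x2s), b_star = (x2s,x2s) *)
  derivable_pt_lim (fun t => K sx sy rho t (- x2s) x2s x2s) (- x2s) 0 /\
  derivable_pt_lim (fun t => K sx sy rho (- x2s) t x2s x2s) (- x2s) 0 /\
  derivable_pt_lim (fun t => K sx sy rho (- x2s) (- x2s) t x2s) x2s 0 /\
  derivable_pt_lim (fun t => K sx sy rho (- x2s) (- x2s) x2s t) x2s 0 /\
  (* a_star is a strict local minimizer of a |-> K(a, b_star) *)
  (exists d : R, 0 < d /\ forall x1 y1 : R,
      (x1, y1) <> (- x2s, - x2s) ->
      (x1 + x2s) ^ 2 + (y1 + x2s) ^ 2 < d ^ 2 ->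
      K sx sy rho (- x2s) (- x2s) x2s x2s < K sx sy rho x1 y1 x2s x2s) /\
  (* b_star is a strict local maximizer of b |-> K(a_star, b) *)
  (exists d : R, 0 < d /\ forall x2 y2 : R,
      (x2, y2) <> (x2s, x2s) ->
      (x2 - x2s) ^ 2 + (y2 - x2s) ^ 2 < d ^ 2 ->
      K sx sy rho (- x2s) (- x2s) x2 y2 < K sx sy rho (- x2s) (- x2s) x2s x2s).
Proof.
  intros s.
  destruct (K_local sx sy rho hsx hsy hr1 hr2 hA hB) as (d & C & Hd & HC & HK).
  fold s in HK.
  assert (Hmin : forall h k, h ^ 2 + k ^ 2 < d ^ 2 ->
    K sx sy rho (- s + h) (- s + k) s s =
    - K sx sy rho (- s) (- s) (s + - h) (s + - k)).
  { intros h k Hhk. destruct (HK (- h) (- k)) as [Hlt _]; [nra|].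
    rewrite <- K_swap_opp by assumption.
    f_equal; ring. }
  assert (K0 : K sx sy rho (- s) (- s) s s = 0).
  { destruct (HK 0 0) as (_ & B & _); [nra|]. rewrite !Rplus_0_r in B.
    apply Rabs_eq_0. pose proof (Rabs_pos (K sx sy rho (- s) (- s) s s)). lra. }
  rewrite K0.
  assert (Hpos : forall h k : R, h <> 0 \/ k <> 0 -> 0 < h ^ 2 + k ^ 2).
  { intros h k Hhk. assert (0 <= h ^ 2 + k ^ 2) by nra.
    destruct Hhk as [Hh|Hh]; apply Rsqr_pos_lt in Hh; unfold Rsqr in Hh; nra. }
  repeat split.
  - apply (derivable_pt_lim_quadratic _ _ C d HC Hd). intros h Hh.
    pose proof (Hmin h 0 ltac:(lra)) as E. rewrite Rplus_0_r in E. rewrite E, Rabs_Ropp.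
    destruct (HK (- h) (- 0)) as (_ & B & _); [lra|].
    apply Rle_trans with (1 := B). lra.
  - apply (derivable_pt_lim_quadratic _ _ C d HC Hd). intros h Hh.
    pose proof (Hmin 0 h ltac:(lra)) as E. rewrite Rplus_0_r in E. rewrite E, Rabs_Ropp.
    destruct (HK (- 0) (- h)) as (_ & B & _); [lra|].
    apply Rle_trans with (1 := B). lra.
  - apply (derivable_pt_lim_quadratic _ _ C d HC Hd). intros h Hh.
    destruct (HK h 0) as (_ & B & _); [lra|]. rewrite Rplus_0_r in B.
    apply Rle_trans with (1 := B). lra.
  - apply (derivable_pt_lim_quadratic _ _ C d HC Hd). intros h Hh.
    destruct (HK 0 h) as (_ & B & _); [lra|]. rewrite Rplus_0_r in B.
    apply Rle_trans with (1 := B). lra.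
  - exists d. split; [exact Hd|]. intros x y Hne Hlt.
    replace x with (- s + (x + s)) by ring. replace y with (- s + (y + s)) by ring.
    rewrite Hmin by exact Hlt.
    destruct (HK (- (x + s)) (- (y + s))) as (_ & _ & N); [lra|].
    enough (0 < (- (x + s)) ^ 2 + (- (y + s)) ^ 2) by (specialize (N ltac:(assumption)); lra).
    apply Hpos. destruct (Req_dec x (- s)) as [ -> |]; [|left; lra].
    destruct (Req_dec y (- s)) as [ -> |]; [now elim Hne|right; lra].
  - exists d. split; [exact Hd|]. intros x y Hne Hlt.
    replace x with (s + (x - s)) by ring. replace y with (s + (y - s)) by ring.
    destruct (HK (x - s) (y - s)) as (_ & _ & N); [lra|].
    apply N, Hpos. destruct (Req_dec x s) as [ -> |]; [|left; lra].
    destruct (Req_dec y s) as [ -> |]; [now elim Hne|right; lra].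
Qed.
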